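(* Let $(V_k)_{k\ge1}$ be a sequence of nonempty finite subsets of $\mathbb N$, let $N_k$ be the number of elements of $V_k$, and suppose $\liminf_{k\to\infty}\frac{N_1N_2\cdots N_k}{(k+1)!}=0$. Then the set $C[\bar O^1,\{V_k\}]$ has Lebesgue measure $0$.
   Context: Every irrational $x\in(0,1)$ has a unique expansion $x=\sum_{n\ge1}\frac{(-1)^{n-1}}{g_1(g_1+g_2)\cdots(g_1+\dots+g_n)}$ with all $g_n\in\mathbb N$; $g_n=g_n(x)$ is the $n$-th $\bar O^1$-symbol of $x$. For a sequence $(V_k)$ of nonempty subsets of $\mathbb N$, $C[\bar O^1,\{V_k\}]$ denotes the closure in $[0,1]$ of the set of irrational $x\in(0,1)$ with $g_k(x)\in V_k$ for all $k\in\mathbb N$. *)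

(* Defs.v *)
From mathcomp Require Import all_boot all_order all_algebra.
From mathcomp Require Import finmap.
From mathcomp Require Import all_classical all_reals all_analysis.
Set Implicit Arguments.
Unset Strict Implicit.
Unset Printing Implicit Defensive.
Import Order.TTheory GRing.Theory Num.Theory numFieldNormedType.Exports.
Local Open Scope classical_set_scope.
Local Open Scope ring_scope.

(* All sequences are indexed from 1, so their value at 0 is irrelevant. *)

Definition barO1_den (g : nat -> nat) (n : nat) : nat :=
  (\prod_(1 <= m < n.+1) \sum_(1 <= i < m.+1) g i)%N.

Definition barO1_psum (R : realType) (g : nat -> nat) (N : nat) : R :=
  \sum_(1 <= n < N.+1) (-1) ^+ n.-1 / (barO1_den g n)%:R.

(* Every irrational x in (0,1) has exactly one such expansion (up to g 0);
   g n is then the n-th symbol of x. *)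
Definition barO1_expansion (R : realType) (x : R) (g : nat -> nat) : Prop :=
  (forall n, (1 <= n)%N -> (0 < g n)%N) /\ barO1_psum R g @ \oo --> x.

Definition barO1_irr (R : realType) (V : nat -> set nat) : set R :=
  [set x | [/\ 0 < x < 1, @irrational R x &
    exists2 g, barO1_expansion x g & forall k, (1 <= k)%N -> V k (g k)]].
Arguments barO1_irr R V : clear implicits.

(* Closure in the subspace [0,1]. *)
Definition C_barO1 (R : realType) (V : nat -> set nat) : set R :=
  closure (barO1_irr R V) `&` `[0, 1].
Arguments C_barO1 R V : clear implicits.

(* Main.v *)
Require Import Defs.
From mathcomp Require Import all_boot all_order all_algebra.
From mathcomp Require Import finmap.
From mathcomp Require Import all_classical all_reals all_analysis.
From mathcomp Require Import lra.
Import Order.TTheory GRing.Theory Num.Theory numFieldNormedType.Exports.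
Local Open Scope classical_set_scope.
Local Open Scope ring_scope.

(* The symbols are positive, so g_1 + ... + g_m >= m and the n-th denominator
   is at least n!.  The expansion is alternating with decreasing terms, hence
   its sum lies within 1/(k+1)! of its k-th partial sum.  Since that partial
   sum only depends on g_1, ..., g_k, the closed set C is covered by N_1...N_k
   closed intervals of length 2/(k+1)!, whose total length is arbitrarily
   small along a subsequence. *)

(** Splitting off the first term leaves [a k] minus the alternating sum started at [k.+1], which by
    induction lies between 0 and [a k.+1 <= a k]. The start [k] therefore stays general in the
    induction on [m]. *)
Lemma alternating_sum_bounds (R : realDomainType) (a : nat -> R)
    (a_ge0 : forall n, 0 <= a n) (a_dec : forall n, a n.+1 <= a n) m k :
  0 <= \sum_(0 <= i < m) (-1) ^+ i * a (k + i)%N <= a k.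
Proof.
elim: m k => [|m IHm] k; first by rewrite big_geq // lexx a_ge0.
rewrite big_nat_recl // expr0 mul1r addn0.
under eq_bigr do rewrite exprS -mulrA mulN1r addnS -addSn.
rewrite sumrN subr_ge0 gerBl.
by case/andP: (IHm k.+1) => -> /le_trans->.
Qed.

Lemma leq_sum_symbols (g : nat -> nat)
    (g_gt0 : forall n, (1 <= n)%N -> (0 < g n)%N) m :
  (m <= \sum_(1 <= i < m.+1) g i)%N.
Proof.
elim: m => // m IHm; rewrite big_nat_recr //=.
by apply: leq_trans (leq_add IHm (g_gt0 m.+1 _)); rewrite ?addn1.
Qed.

Lemma barO1_denS (g : nat -> nat) n :
  barO1_den g n.+1 = (barO1_den g n * \sum_(1 <= i < n.+2) g i)%N.
Proof. by rewrite /barO1_den big_nat_recr. Qed.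

Lemma fact_le_barO1_den (g : nat -> nat)
    (g_gt0 : forall n, (1 <= n)%N -> (0 < g n)%N) n :
  (n`! <= barO1_den g n)%N.
Proof.
elim: n => [|n IHn]; first by rewrite /barO1_den big_geq.
by rewrite barO1_denS factS mulnC leq_mul // leq_sum_symbols.
Qed.

Lemma eq_barO1_psum (R : realType) (g h : nat -> nat) n :
  (forall i, (1 <= i <= n)%N -> g i = h i) ->
  barO1_psum R g n = barO1_psum R h n.
Proof.
move=> gh; apply: eq_big_nat => i /andP[_ lein]; congr (_ / _%:R).
apply: eq_big_nat => j /andP[_ leji]; apply: eq_big_nat => l /andP[l1 lelj].
apply: gh; rewrite l1 /=; move: lelj leji lein; rewrite !ltnS.
by move=> /leq_trans le1 /le1 /leq_trans; apply.
Qed.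

Lemma barO1_psum_near (R : realType) (x : R) (g : nat -> nat) k :
  barO1_expansion x g -> `|x - barO1_psum R g k| <= (k.+1)`!%:R^-1.
Proof.
case=> g_gt0 gx.
have den_gt0 n : (0 < barO1_den g n)%N.
  by rewrite (leq_trans (fact_gt0 n)) // fact_le_barO1_den.
pose a n : R := (barO1_den g n)%:R^-1.
have a_ge0 n : 0 <= a n by rewrite invr_ge0.
(* Consecutive denominators differ by the factor [g 1 + ... + g n.+1], which is at least [n.+1],
   hence positive. *)
have a_dec n : a n.+1 <= a n.
  rewrite lef_pV2 ?posrE ?ltr0n // ler_nat barO1_denS leq_pmulr //.
  exact: leq_trans (leq_sum_symbols _ g_gt0 _).
(* The term of index [k.+1 + i] has sign [(-1) ^+ (k + i)], so [(-1) ^+ k] factors out of the tail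
   and later disappears under the norm. *)
have psumD m : barO1_psum R g (m + k) =
    barO1_psum R g k + (-1) ^+ k * \sum_(0 <= i < m) (-1) ^+ i * a (k.+1 + i)%N.
  elim: m => [|m IHm]; first by rewrite big_geq // mulr0 addr0.
  rewrite addSn /barO1_psum big_nat_recr //= -/(barO1_psum R g (m + k)) IHm.
  rewrite -/(barO1_psum R g k) (@big_nat_recr _ _ _ m 0%N) //= mulrDr addrA.
  by rewrite mulrA -exprD addSn [(k + m)%N]addnC.
(* A bound on the finite tails that is uniform in [m] survives the passage to the limit. *)
suff tail m : `|barO1_psum R g (m + k) - barO1_psum R g k| <= (k.+1)`!%:R^-1.
  have cgx : `|barO1_psum R g n - barO1_psum R g k| @[n --> \oo] -->
      `|x - barO1_psum R g k|.
    by apply: cvg_norm; apply: cvgB => //; exact: cvg_cst.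
  rewrite -(cvg_lim _ cgx) //; apply: limr_le.
    by apply/cvg_ex; eexists; exact: cgx.
  exists k => // n /= kn; rewrite -(subnK kn); exact: tail.
rewrite psumD addrAC subrr add0r normrM normrX normrN1 expr1n mul1r.
case/andP: (@alternating_sum_bounds _ a a_ge0 a_dec m k.+1) => s0 /le_trans sa.
rewrite ger0_norm // sa // lef_pV2 ?posrE ?ltr0n ?fact_gt0 //.
by rewrite ler_nat fact_le_barO1_den.
Qed.

(* Position 0 of a word is a dummy, matching the 1-based indexing. *)
Fixpoint words (V : nat -> set nat) k : seq (seq nat) :=
  if k is k'.+1 then
    [seq rcons w v | w <- words V k', v <- fset_set (V k'.+1)]
  else [:: [:: 0%N]].

Lemma size_words (V : nat -> set nat) k :
  size (words V k) = (\prod_(1 <= i < k.+1) #|` fset_set (V i)|)%N.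
Proof.
elim: k => [|k IHk]; first by rewrite big_geq.
by rewrite big_nat_recr //= size_allpairs IHk.
Qed.

Lemma words_mem (V : nat -> set nat) (g : nat -> nat) k :
  (forall i, (1 <= i)%N -> finite_set (V i)) ->
  (forall i, (1 <= i)%N -> V i (g i)) ->
  0%N :: [seq g i | i <- iota 1 k] \in words V k.
Proof.
move=> V_fin gV; elim: k => [|k IHk]; first by rewrite inE.
have -> : 0%N :: [seq g i | i <- iota 1 k.+1] =
    rcons (0%N :: [seq g i | i <- iota 1 k]) (g k.+1).
  by rewrite -[k.+1]addn1 iotaD map_cat cats1 addnC.
apply: (allpairs_f (@rcons nat)) => //.
by rewrite in_fset_set; [exact/mem_set/gV|exact: V_fin].
Qed.

Lemma measure_bigsetU_ball (R : realType) (T : eqType) (c : T -> R)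
    (s : seq T) (r : R) :
  0 <= r ->
  (lebesgue_measure (\big[setU/set0]_(t <- s) [set` `[c t - r, c t + r]%R])
   <= ((size s)%:R * (2 * r))%:E)%E.
Proof.
move=> r0; elim: s => [|t s IHs]; first by rewrite big_nil measure0 mul0r.
rewrite big_cons /= -[in leRHS]add1n natrD mulrDl mul1r EFinD.
apply: le_trans (measureU2 _ _ _) _.
- exact: measurable_itv.
- by apply: bigsetU_measurable => i _; exact: measurable_itv.
apply: leeD; last exact: IHs.
(* The length formula asks whether the endpoints are strictly ordered; for [r = 0] the interval is a
   point of measure 0. *)
rewrite [leLHS](lebesgue_measure_itv `[c t - r, c t + r]) /= lte_fin; case: ifP => _.
  by rewrite -EFinB lee_fin; lra.
by rewrite lee_fin mulr_ge0.
Qed.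

Lemma measure_C_barO1_le (R : realType) (V : nat -> set nat) k :
  (forall i, (1 <= i)%N -> finite_set (V i)) ->
  (lebesgue_measure (C_barO1 R V)
   <= ((\prod_(1 <= i < k.+1) #|` fset_set (V i)|)%N%:R
        * (2 * (k.+1)`!%:R^-1))%:E)%E.
Proof.
move=> V_fin.
have r0 : 0 <= (k.+1)`!%:R^-1 :> R by rewrite invr_ge0.
pose c w := barO1_psum R (nth 0%N w) k.
rewrite -size_words; apply: le_trans (@measure_bigsetU_ball _ _ c _ _ r0).
have clU : closed (\big[setU/set0]_(w <- words V k)
    `[c w - (k.+1)`!%:R^-1, c w + (k.+1)`!%:R^-1]%classic).
  by apply: closed_bigsetU => w _; exact: itv_closed.
apply: le_measure; rewrite ?inE.
- apply: measurableI; last exact: measurable_itv.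
  exact: measurable_realfun.closed_measurable (@closed_closure _ _).
- exact: measurable_realfun.closed_measurable.
(* The finite union is closed, so it equals its closure, and only the points of [barO1_irr] have to
   be covered. *)
move=> x [+ _]; rewrite [X in _ -> X x](closure_id _).1 //.
apply: closure_subset => {}x [_ _ [g gx gV]].
rewrite -bigcup_seq; exists (0%N :: [seq g i | i <- iota 1 k]).
  exact: words_mem.
(* Thanks to the dummy head, position [i] of the word holds [g i] for [1 <= i <= k]; position 0
   never enters the partial sum. *)
have -> : c (0%N :: [seq g i | i <- iota 1 k]) = barO1_psum R g k.
  apply: eq_barO1_psum => -[//|i] /andP[_ ik] /=.
  by rewrite (nth_map 0%N) ?size_iota // nth_iota.
by rewrite /= in_itv /= -ler_distl; exact: barO1_psum_near.
Qed.

(** The lower limit is the limit of the infima over tails, each of which is at least [l]. *)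
Lemma limn_einf_ge (R : realType) (u : nat -> \bar R) (l : \bar R) :
  (forall n, l <= u n)%E -> (l <= limn_einf u)%E.
Proof.
move=> lu; rewrite limn_einf_lim; apply: lime_ge; first exact: is_cvg_einfs.
by apply: nearW => n; apply: le_ereal_inf_tmp => _ [m _ <-].
Qed.

Theorem theorem3 (R : realType) (V : nat -> set nat)
  (V_pos : forall k, (1 <= k)%N -> V k `<=` [set n | (0 < n)%N])
  (V_neq0 : forall k, (1 <= k)%N -> V k !=set0)
  (V_fin : forall k, (1 <= k)%N -> finite_set (V k))
  (N : nat -> nat)
  (N_card : forall k, (1 <= k)%N -> N k = #|` fset_set (V k)|)
  (N_liminf : limn_einf (fun k : nat =>
     ((\prod_(1 <= i < k.+1) N i)%N%:R / (k.+1)`!%:R : R)%:E) = 0%E) :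
  lebesgue_measure (C_barO1 R V) = 0%E.
Proof.
have mu_le k := @measure_C_barO1_le R V k V_fin.
(* The case [k = 0], a single interval of length 2, already gives finiteness, so the measure can be
   handled as a real number. *)
have mu_fin : lebesgue_measure (C_barO1 R V) \is a fin_num.
  by rewrite ge0_fin_numE // (le_lt_trans (mu_le 0%N)) ?ltry.
apply/eqP; rewrite eq_le measure_ge0 andbT.
rewrite -(fineK mu_fin) lee_fin.
(* Halving absorbs the 2 in the interval length [2 / (k+1)!]: half the measure is at most every
   quotient in [N_liminf], hence at most their lower limit 0. *)
suff : ((fine (lebesgue_measure (C_barO1 R V)) / 2)%:E <= 0 :> \bar R)%E.
  by rewrite lee_fin; lra.
rewrite -N_liminf; apply: limn_einf_ge => k.
have := mu_le k; rewrite -{1}(fineK mu_fin) !lee_fin.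
rewrite (eq_big_nat _ _ (F2 := N)); last by move=> i /andP[i1 _]; rewrite N_card.
by rewrite mulrCA mulrC; lra.
Qed.
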